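(* A general convex quadrilateral $K\subset\mathbb{R}^2$ satisfies the $MAC$ and the $clos$ (respectively, the $DAC$ and the $clos$) if and only if $K$ is equivalent to a reference element $K(a,b,\tilde a,\tilde b)$ verifying conditions $(D1')$ and $(D2)$, with the constants on each side depending only on the constants on the other side. Precisely: (i) For all $0<\psi_M<\pi$ and $0<C_*\le C^*$ there exist constants $M>0$, $C>0$ and $0<C_0<1$, depending only on $\psi_M,C_*,C^*$, such that every convex quadrilateral $K$ satisfying $MAC(\psi_M)$ and $clos(C_*,C^* )$ satisfies $K\equiv_M K(a,b,\tilde a,\tilde b)$ for some reference element $K(a,b,\tilde a,\tilde b)$ verifying $(D1')$ with constant $C_0$ and $(D2)$ with constant $C$. (Respectively: the same holds for every $K$ satisfying $DAC(\psi_m,\psi_M)$ and $clos(C_*,C^* )$, with constants depending only on $\psi_m,\psi_M,C_*,C^*$.) (ii) Conversely, for all $M>0$, $C>0$ and $0<C_0<1$ there exist constants $0<\psi_m\le\psi_M<\pi$ and $0<C_*\le C^*$, depending only on $M,C,C_0$, such that every convex quadrilateral $K$ with $K\equiv_M K(a,b,\tilde a,\tilde b)$ for some reference element verifying $(D1')$ with constant $C_0$ and $(D2)$ with constant $C$ satisfies $MAC(\psi_M)$ and $clos(C_*,C^* )$ (respectively, $DAC(\psi_m,\psi_M)$ and $clos(C_*,C^* )$).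
   Context: A convex quadrilateral $K$ satisfies $MAC(\psi_M)$ if all its inner angles $\theta$ satisfy $\theta\le\psi_M<\pi$; it satisfies $mac(\psi_m)$ if all its inner angles satisfy $0<\psi_m\le\theta$; it satisfies $DAC(\psi_m,\psi_M)$ if it satisfies both $MAC(\psi_M)$ and $mac(\psi_m)$. It satisfies $clos(C_*,C^* )$ if for any two opposite sides $s_1,s_2$ of $K$ one has $C_*\le |s_1|/|s_2|\le C^*$. For $a,b,\tilde a,\tilde b>0$, the reference element $K(a,b,\tilde a,\tilde b)$ is a convex quadrilateral with vertices (in counterclockwise order) $V_1=(0,0)$, $V_2=(a,0)$, $V_3=(\tilde a,\tilde b)$, $V_4=(0,b)$. Condition $(D1')$ with constant $C_0$: $C_0\le \tilde a/a\le 1$ and $C_0\le\tilde b/b\le 1$. Condition $(D2)$ with constant $C$: $1/\sin(\alpha)\le C$, where $\alpha$ is the angle at $V_4$ of the triangle with vertices $V_2,V_3,V_4$. Quadrilaterals $K_1$ and $K_2$ are equivalent with constant $M$, written $K_1\equiv_M K_2$, if there exists an invertible affine mapping $L(x)=Bx+P$ with $L(K_1)=K_2$ and $\|B\|,\|B^{-1}\|\le M$ (operator norms induced by the Euclidean norm). *)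

(* Defs.v *)
From HB Require Import structures.
From mathcomp Require Import all_boot all_order all_algebra.
From mathcomp Require Import all_classical all_reals all_analysis.

Set Implicit Arguments.
Unset Strict Implicit.
Unset Printing Implicit Defensive.

Import Order.TTheory GRing.Theory Num.Theory.
Local Open Scope classical_set_scope.
Local Open Scope ring_scope.

Section Plane.
Context {R : realType}.
Implicit Types u v P Q S : 'cV[R]_2.

Definition pt (x y : R) : 'cV[R]_2 := \col_i (if i == 0 then x else y).

Definition dotp u v : R := \sum_i u i 0 * v i 0.

(* The library norm on matrices is the sup norm, hence this one. *)
Definition enorm u : R := Num.sqrt (dotp u u).

Definition cross u v : R := u 0 0 * v 1 0 - u 1 0 * v 0 0.

(* Unoriented angle at Q between the rays QP and QS, with values in [0, pi]. *)
Definition angle P Q S : R :=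
  acos (dotp (P - Q) (S - Q) / (enorm (P - Q) * enorm (S - Q))).

Definition opnorm (B : 'M[R]_2) : R :=
  sup [set enorm (B *m x) | x in [set x : 'cV[R]_2 | enorm x <= 1]].

(* A quadrilateral is given by its four vertices; i + 1, i - 1 and i + 2 are
   taken modulo 4, so that i + 1 and i - 1 index the neighbours of vertex i. *)
Implicit Type K : 'I_4 -> 'cV[R]_2.

(* Four left turns in (0, pi) have total turning 2 pi: the closed polygon is
   then simple, strictly convex and listed counterclockwise. *)
Definition convex_quad K : Prop :=
  forall i, 0 < cross (K (i + 1) - K i) (K (i + 2) - K (i + 1)).

(* The closed subset of the plane enclosed by a convex quadrilateral. *)
Definition region K : set 'cV[R]_2 :=
  [set x | exists w : 'I_4 -> R,
    [/\ forall i, 0 <= w i, \sum_i w i = 1 & x = \sum_i w i *: K i]].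

Definition inner_angle K (i : 'I_4) : R := angle (K (i + 1)) (K i) (K (i - 1)).

Definition side K (i : 'I_4) : R := enorm (K (i + 1) - K i).

Definition MAC (psiM : R) K : Prop :=
  psiM < pi /\ forall i, inner_angle K i <= psiM.

Definition mac (psim : R) K : Prop :=
  0 < psim /\ forall i, psim <= inner_angle K i.

Definition DAC (psim psiM : R) K : Prop := MAC psiM K /\ mac psim K.

(* Letting i range over all four indices covers both orders of each pair of
   opposite sides. *)
Definition clos (Cl Cu : R) K : Prop :=
  forall i, Cl <= side K i / side K (i + 2) <= Cu.

Definition ref_quad (a b at_ bt : R) : 'I_4 -> 'cV[R]_2 :=
  fun i => nth 0 [:: pt 0 0; pt a 0; pt at_ bt; pt 0 b] i.

Definition reference_element (a b at_ bt : R) : Prop :=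
  [/\ 0 < a, 0 < b, 0 < at_, 0 < bt & convex_quad (ref_quad a b at_ bt)].

Definition D1' (C0 a b at_ bt : R) : Prop :=
  C0 <= at_ / a <= 1 /\ C0 <= bt / b <= 1.

(* On a reference element the sine is positive, since convexity makes the
   triangle nondegenerate; the convention 0^-1 = 0 plays no role. *)
Definition D2 (C a b at_ bt : R) : Prop :=
  1 / sin (angle (pt a 0) (pt 0 b) (pt at_ bt)) <= C.

(* The affine map acts on the plane regions: no matching of the vertex
   numberings, nor preservation of orientation, is imposed. *)
Definition affine_equiv (M : R) K1 K2 : Prop :=
  exists (B : 'M[R]_2) (P : 'cV[R]_2),
    [/\ B \in unitmx,
        [set B *m x + P | x in region K1] = region K2,
        opnorm B <= M & opnorm (invmx B) <= M].

Definition equiv_to_reference (M C C0 : R) K : Prop :=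
  exists a b at_ bt : R,
    [/\ reference_element a b at_ bt, D1' C0 a b at_ bt, D2 C a b at_ bt
      & affine_equiv M K (ref_quad a b at_ bt)].

End Plane.

(* Main.v *)
(* Let [T i] be the cross product of the two sides of [K] issued from its vertex
   [i]; then T 0 + T 2 = T 1 + T 3.  If [T 0] is the largest, write
   K 2 - K 0 = s (K 1 - K 0) + t (K 3 - K 0): here s = T 3 / T 0 <= 1,
   t = T 1 / T 0 <= 1 and s + t - 1 = T 2 / T 0, so sending the two sides at
   [K 0] isometrically to the axes yields a reference element, and all its
   constants are controlled by [clos] and by lower bounds for the sines of the
   inner angles.  Such bounds follow from [MAC] and [clos] alone: the angles at
   0 and 1 (or 3) add up to at most pi, hence those at 2 and 1 (or 3) to at
   least pi, so the angles at 1 and 3 lie in [pi - psiM, psiM]; [clos] and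
   T 1 <= T 0 then bound the sine at 0 from below, and the angle at 2 is at
   least the one at 0.
   Conversely, an affine map between the regions maps vertices to vertices and
   opposite vertices to opposite vertices, and changes lengths and sines by
   bounded factors, so that it is enough to estimate the reference element. *)

Require Import Defs.
From HB Require Import structures.
From mathcomp Require Import all_boot all_order all_algebra.
From mathcomp Require Import all_classical all_reals all_analysis.
From mathcomp Require Import ring lra.
Import Order.TTheory GRing.Theory Num.Theory.
Local Open Scope classical_set_scope.
Local Open Scope ring_scope.

(** * Plane vectors and 2 x 2 matrices *)

Section PlaneGeometry.
Context {R : realType}.
Implicit Types (u v w x y : 'cV[R]_2) (A B : 'M[R]_2).

Lemma cV2P u v : u 0 0 = v 0 0 -> u 1 0 = v 1 0 -> u = v.
Proof.
move=> h0 h1; apply/matrixP => i j; rewrite (ord1 j).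
by case: i => [[|[|//]]] i2; [move: h0|move: h1];
   congr (_ = _); congr fun_of_matrix; apply/val_inj.
Qed.

Lemma ptE (s t : R) : (pt s t 0 0 = s) * (pt s t 1 0 = t).
Proof. by rewrite !mxE. Qed.

Lemma dotpE u v : dotp u v = u 0 0 * v 0 0 + u 1 0 * v 1 0.
Proof. by rewrite /dotp big_ord_recl big_ord1; congr (_ + u _ _ * v _ _); apply/val_inj. Qed.

Lemma mulmx2E A u i : (A *m u) i 0 = A i 0 * u 0 0 + A i 1 * u 1 0.
Proof. by rewrite mxE big_ord_recl big_ord1; congr (_ + A _ _ * u _ _); apply/val_inj. Qed.

Lemma dotp_ge0 u : 0 <= dotp u u.
Proof. by rewrite dotpE; nra. Qed.

Lemma enorm_ge0 u : 0 <= enorm u. Proof. exact: sqrtr_ge0. Qed.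

Lemma sqr_enorm u : enorm u ^+ 2 = dotp u u.
Proof. by rewrite sqr_sqrtr // dotp_ge0. Qed.

Lemma enorm_sqrE u : enorm u ^+ 2 = u 0 0 ^+ 2 + u 1 0 ^+ 2.
Proof. by rewrite sqr_enorm dotpE !expr2. Qed.

Lemma lagrange u v : dotp u v ^+ 2 + cross u v ^+ 2 = (enorm u * enorm v) ^+ 2.
Proof. by rewrite exprMn !sqr_enorm !dotpE /cross; ring. Qed.

Lemma enorm_eq0 u : enorm u = 0 -> u = 0.
Proof.
move=> u0; have := enorm_sqrE u; rewrite u0 expr0n /= => /esym/eqP.
rewrite paddr_eq0 ?sqr_ge0 // !sqrf_eq0 => /andP[/eqP h0 /eqP h1].
by apply: cV2P; rewrite mxE.
Qed.

Lemma enorm0 : enorm (0 : 'cV[R]_2) = 0.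
Proof. by rewrite /enorm dotpE !mxE mul0r addr0 sqrtr0. Qed.

Lemma enormN u : enorm (- u) = enorm u.
Proof. by rewrite /enorm !dotpE !mxE !mulrNN. Qed.

Lemma enormB u v : enorm (u - v) = enorm (v - u).
Proof. by rewrite -enormN opprB. Qed.

Lemma enormZ (k : R) u : enorm (k *: u) = `|k| * enorm u.
Proof.
apply: (@pexpIrn _ 2) => //; rewrite ?nnegrE ?enorm_ge0 ?mulr_ge0 ?enorm_ge0 //.
by rewrite exprMn real_normK ?num_real // !enorm_sqrE !mxE; ring.
Qed.

Lemma dotp_le u v : `|dotp u v| <= enorm u * enorm v.
Proof.
rewrite -(@ler_pXn2r _ 2) ?nnegrE ?mulr_ge0 ?enorm_ge0 //.
by rewrite real_normK ?num_real // -lagrange lerDl sqr_ge0.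
Qed.

Lemma cross_le u v : `|cross u v| <= enorm u * enorm v.
Proof.
rewrite -(@ler_pXn2r _ 2) ?nnegrE ?mulr_ge0 ?enorm_ge0 //.
by rewrite real_normK ?num_real // -lagrange lerDr sqr_ge0.
Qed.

Lemma ler_enormD u v : enorm (u + v) <= enorm u + enorm v.
Proof.
rewrite -(@ler_pXn2r _ 2) ?nnegrE ?addr_ge0 ?enorm_ge0 //.
have -> : enorm (u + v) ^+ 2 = enorm u ^+ 2 + enorm v ^+ 2 + dotp u v *+ 2.
  by rewrite !enorm_sqrE dotpE !mxE; ring.
have := le_trans (ler_norm _) (dotp_le u v); rewrite sqrrD; lra.
Qed.

Lemma coord_le_enorm u i : `|u i 0| <= enorm u.
Proof.
rewrite -(@ler_pXn2r _ 2) ?nnegrE ?enorm_ge0 // real_normK ?num_real // enorm_sqrE.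
have [->|->] : i = 0 \/ i = 1 by case: i => [[|[|//]]] i2; [left|right]; apply/val_inj.
  by rewrite lerDl sqr_ge0.
by rewrite lerDr sqr_ge0.
Qed.

Lemma enorm_le_coord u : enorm u <= `|u 0 0| + `|u 1 0|.
Proof.
rewrite -(@ler_pXn2r _ 2) ?nnegrE ?addr_ge0 ?enorm_ge0 // enorm_sqrE sqrrD.
by rewrite !real_normK ?num_real //; have := normr_ge0 (u 0 0); have := normr_ge0 (u 1 0); nra.
Qed.

Lemma enorm_gt0_crossl u v : cross u v != 0 -> 0 < enorm u.
Proof.
rewrite lt_def enorm_ge0 andbT; apply: contraNneq => /enorm_eq0 ->.
by rewrite /cross !mxE !mul0r subr0.
Qed.

Lemma crossC u v : cross u v = - cross v u.
Proof. by rewrite /cross; ring. Qed.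

Lemma enorm_gt0_crossr u v : cross u v != 0 -> 0 < enorm v.
Proof. by rewrite crossC oppr_eq0; apply: enorm_gt0_crossl. Qed.

(** A supremum bounds the elements of a set only once the set is known to be bounded above; here the
    sum of the absolute values of the entries is an upper bound. *)
Lemma opnorm_bounded B :
  has_ubound [set enorm (B *m x) | x in [set x : 'cV[R]_2 | enorm x <= 1]].
Proof.
exists (`|B 0 0| + `|B 0 1| + (`|B 1 0| + `|B 1 1|)) => _ [x /= x1 <-].
have c0 := le_trans (coord_le_enorm x 0) x1.
have c1 := le_trans (coord_le_enorm x 1) x1.
apply: (le_trans (enorm_le_coord _)); rewrite !mulmx2E.
by apply: lerD; apply: (le_trans (ler_normD _ _)); rewrite !normrM;
   apply: lerD; apply: ler_piMr.
Qed.

Lemma enorm_mulmx_le B x : enorm (B *m x) <= opnorm B * enorm x.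
Proof.
have [x0|x0] := eqVneq (enorm x) 0.
  by rewrite (enorm_eq0 _ x0) mulmx0 enorm0 mulr0.
have xp : 0 < enorm x by rewrite lt_def x0 enorm_ge0.
have : enorm (B *m ((enorm x)^-1 *: x)) <= opnorm B.
  apply: ub_le_sup; first exact: opnorm_bounded.
  by exists ((enorm x)^-1 *: x) => //=; rewrite enormZ gtr0_norm ?invr_gt0 // mulVf.
by rewrite -scalemxAr enormZ gtr0_norm ?invr_gt0 // ler_pdivrMl // mulrC.
Qed.

Lemma opnorm_le B (M : R) :
  (forall x, enorm x <= 1 -> enorm (B *m x) <= M) -> opnorm B <= M.
Proof.
move=> BM; apply: ge_sup; last by move=> _ [x /= x1 <-]; exact: BM.
by exists (enorm (B *m 0)), 0 => //=; rewrite enorm0.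
Qed.

Lemma det2E B : \det B = B 0 0 * B 1 1 - B 1 0 * B 0 1.
Proof.
rewrite (expand_det_row _ 0) big_ord_recl big_ord1 /cofactor !det_mx11 !mxE /=.
rewrite expr0 expr1 mul1r mulN1r mulrN [B 1 0 * _]mulrC.
by congr (B _ _ * B _ _ - B _ _ * B _ _); apply/val_inj.
Qed.

Lemma cross_mulmx B u v : cross (B *m u) (B *m v) = \det B * cross u v.
Proof. by rewrite det2E /cross !mulmx2E; ring. Qed.

Lemma cos_div_bound u v : -1 <= dotp u v / (enorm u * enorm v) <= 1.
Proof.
rewrite -ler_norml normrM normfV (ger0_norm (mulr_ge0 (enorm_ge0 _) (enorm_ge0 _))).
have := mulr_ge0 (enorm_ge0 u) (enorm_ge0 v); rewrite le_eqVlt => /predU1P[<-|uv0].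
  by rewrite invr0 mulr0.
by rewrite ler_pdivrMr // mul1r dotp_le.
Qed.

Lemma sin_cos_unit u v : cross u v != 0 ->
  (dotp u v / (enorm u * enorm v)) ^+ 2 + (cross u v / (enorm u * enorm v)) ^+ 2 = 1.
Proof.
move=> uv; rewrite !exprMn -mulrDl lagrange exprVn mulfV // sqrf_eq0.
by rewrite mulf_neq0 // gt_eqF // ?(enorm_gt0_crossl _ _ uv) ?(enorm_gt0_crossr _ _ uv).
Qed.

End PlaneGeometry.

(** * Corners of a quadrilateral *)

(** Normal forms modulo 4: computations at a generic vertex [i] then meet only the indices [i],
    [i + 1], [i + 2] and [i - 1]. *)
Lemma I4E (i : 'I_4) :
  (i + 1 + 1 = i + 2) * (i + 1 - 1 = i) * (i + 1 + 2 = i - 1) *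
  ((i + 2 + 1 = i - 1) * (i + 2 - 1 = i + 1) * (i + 2 + 2 = i)) *
  ((i - 1 + 1 = i) * (i - 1 - 1 = i + 2) * (i - 1 + 2 = i + 1)).
Proof. by case: i => [[|[|[|[|//]]]]] i4; do !split; apply/val_inj. Qed.

Lemma I4P (i j : 'I_4) : [\/ j = i, j = i + 1, j = i + 2 | j = i - 1].
Proof.
by case: i j => [[|[|[|[|//]]]]] i4 [[|[|[|[|//]]]]] j4;
   (apply: Or41; exact: val_inj) || (apply: Or42; exact: val_inj) ||
   (apply: Or43; exact: val_inj) || (apply: Or44; exact: val_inj).
Qed.

Section Corners.
Context {R : realType}.
Implicit Types (K : 'I_4 -> 'cV[R]_2) (i j : 'I_4).

(** Twice the signed area of the triangle formed by vertex [i] and its two neighbours. *)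
Definition corner K i : R := cross (K (i + 1) - K i) (K (i - 1) - K i).

Definition sine K i : R := corner K i / (side K i * side K (i - 1)).

Definition cosine K i : R :=
  dotp (K (i + 1) - K i) (K (i - 1) - K i) / (side K i * side K (i - 1)).

Lemma side_prev K i : side K (i - 1) = enorm (K (i - 1) - K i).
Proof. by rewrite /side I4E enormB. Qed.

Lemma inner_angleE K i : inner_angle K i = acos (cosine K i).
Proof. by rewrite /cosine side_prev. Qed.

(** The turn recorded at index [i] in [convex_quad] takes place at vertex [i + 1], hence the shifted
    indices. *)
Lemma corner_gt0 K : convex_quad K <-> forall i, 0 < corner K i.
Proof.
split=> cK i; [have := cK (i - 1)|have := cK (i + 1)]; rewrite /corner !I4E;
  set t := cross _ _; set t' := cross _ _; suff -> : t = t' by [];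
  by rewrite /t /t' /cross !mxE; ring.
Qed.

(** Both sides are twice the signed area of the quadrilateral, cut along one diagonal or along the
    other. *)
Lemma corner_add K i : corner K i + corner K (i + 2) = corner K (i + 1) + corner K (i - 1).
Proof. by rewrite /corner !I4E /cross !mxE; ring. Qed.

(** * Sines and cosines of the inner angles of a convex quadrilateral *)

Section Convex.
Variable K : 'I_4 -> 'cV[R]_2.
Hypothesis cK : convex_quad K.

Let corner_neq0 i : corner K i != 0.
Proof. by rewrite gt_eqF //; move/corner_gt0: cK. Qed.

Lemma side_gt0 i : 0 < side K i.
Proof. exact: enorm_gt0_crossl (corner_neq0 i). Qed.

Lemma sine_gt0 i : 0 < sine K i.
Proof. by rewrite divr_gt0 ?mulr_gt0 ?side_gt0 //; move/corner_gt0: cK. Qed.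

Lemma cornerE i : corner K i = sine K i * (side K i * side K (i - 1)).
Proof. by rewrite /sine divfK // mulf_neq0 // gt_eqF // side_gt0. Qed.

Lemma cosine_bound i : -1 <= cosine K i <= 1.
Proof. by rewrite /cosine side_prev cos_div_bound. Qed.

Lemma cosine2_sine2 i : cosine K i ^+ 2 + sine K i ^+ 2 = 1.
Proof. by rewrite /cosine /sine side_prev sin_cos_unit // corner_neq0. Qed.

(* The sign of [sin (a + b)] is that of [cos a + cos b], because
   [(cos a + cos b) (sin a + sin b) = (1 + cos (a - b)) sin (a + b)]. *)
Lemma sine_add_factor i :
  exists2 k, 0 <= k & (cosine K i + cosine K (i + 1)) * (sine K i + sine K (i + 1)) =
    k * (corner K i - corner K (i - 1)).
Proof.
have h1 := cosine2_sine2 i; have h2 := cosine2_sine2 (i + 1).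
have lp := side_gt0 i; have lp1 := side_gt0 (i + 1); have lp2 := side_gt0 (i - 1).
exists ((1 + cosine K i * cosine K (i + 1) + sine K i * sine K (i + 1)) /
         (side K (i + 1) * side K (i - 1))).
  apply: divr_ge0; last by rewrite mulr_ge0 ?ltW.
  (* The sum of these two squares is twice [1 + cos (a - b)]. *)
  have := addr_ge0 (sqr_ge0 (cosine K i + cosine K (i + 1))) (sqr_ge0 (sine K i + sine K (i + 1))).
  by lra.
have -> : (cosine K i + cosine K (i + 1)) * (sine K i + sine K (i + 1)) =
  (1 + cosine K i * cosine K (i + 1) + sine K i * sine K (i + 1)) *
  (sine K i * cosine K (i + 1) + cosine K i * sine K (i + 1)).
  apply/eqP; rewrite eq_sym -subr_eq0; apply/eqP.
  transitivity (
      cosine K i * sine K i * (cosine K (i + 1) ^+ 2 + sine K (i + 1) ^+ 2 - 1) +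
      cosine K (i + 1) * sine K (i + 1) * (cosine K i ^+ 2 + sine K i ^+ 2 - 1)).
    by ring.
  by rewrite h1 h2 subrr !mulr0 addr0.
rewrite -!mulrA; congr (_ * _).
(* It remains to compute [sin (a + b)]; once the denominators are cleared and [side K i ^+ 2] is
   expanded, this is a polynomial identity in the coordinates. *)
have hl : side K i ^+ 2 = dotp (K (i + 1) - K i) (K (i + 1) - K i) by rewrite /side sqr_enorm.
rewrite /sine /cosine !I4E.
have nz := (gt_eqF lp, gt_eqF lp1, gt_eqF lp2).
apply: (@mulIf _ (side K i ^+ 2 * side K (i + 1) * side K (i - 1))).
  by rewrite !mulf_neq0 ?expf_neq0 ?nz.
transitivity (corner K i * dotp (K (i + 2) - K (i + 1)) (K i - K (i + 1)) +
  dotp (K (i + 1) - K i) (K (i - 1) - K i) * corner K (i + 1)).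
  by field; rewrite ?nz.
transitivity ((corner K i - corner K (i - 1)) * side K i ^+ 2); last by field; rewrite ?nz.
rewrite hl /corner !dotpE /cross !I4E !mxE; ring.
Qed.

(** The two triangles share the side from [K (i - 1)] to [K i], so the hypothesis compares the
    distances of [K (i + 1)] and [K (i + 2)] to that line. When the former is at least the latter,
    the angles at [i] and [i + 1] add up to at most pi. *)
Lemma cosine_add_ge0 i :
  corner K (i - 1) <= corner K i -> 0 <= cosine K i + cosine K (i + 1).
Proof.
move=> ci; have [k k0 E] := sine_add_factor i.
rewrite -(pmulr_lge0 _ (addr_gt0 (sine_gt0 i) (sine_gt0 (i + 1)))) E.
by rewrite mulr_ge0 // subr_ge0.
Qed.

Lemma cosine_add_le0 i :
  corner K i <= corner K (i - 1) -> cosine K i + cosine K (i + 1) <= 0.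
Proof.
move=> ci; have [k k0 E] := sine_add_factor i.
rewrite -(pmulr_lle0 _ (addr_gt0 (sine_gt0 i) (sine_gt0 (i + 1)))) E.
by rewrite mulr_ge0_le0 // subr_le0.
Qed.

Lemma cos_le_cosine (psi : R) i : 0 < psi < pi -> MAC psi K -> cos psi <= cosine K i.
Proof.
move=> /andP[p0 ppi] [_ /(_ i)]; rewrite inner_angleE => le_psi.
have cb := cosine_bound i.
rewrite -(acosK (x := cosine K i)) ?in_itv //= leNgt ltr_cos ?in_itv /= -?leNgt
  ?acos_ge0 ?acos_lepi //.
by rewrite !ltW.
Qed.

(** The minimum with 1 lets one constant serve all vertices: the bound is [sin psi] at the
    neighbours of [i], a factor [Cl] may be lost at [i], and the vertex [i + 2] inherits one of
    these two bounds. *)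
Lemma sine_ge (psi Cl Cu : R) i j : 0 < psi < pi -> 0 < Cl ->
  MAC psi K -> clos Cl Cu K -> (forall j, corner K j <= corner K i) ->
  sin psi * Num.min 1 Cl <= sine K j.
Proof.
move=> psiB Cl0 mac clo imax.
have s0 : 0 < sin psi by exact: sin_gt0_pi.
have mE : cos psi ^+ 2 + sin psi ^+ 2 = 1 by rewrite cos2Dsin2.
have [minl minr] : Num.min 1 Cl <= 1 /\ Num.min 1 Cl <= Cl.
  by split; rewrite ge_min lexx ?orbT.
have min0 : 0 < Num.min 1 Cl by rewrite lt_min ltr01.
have weak j' : sin psi <= sine K j' -> sin psi * Num.min 1 Cl <= sine K j'.
  by apply: le_trans; rewrite ler_piMr // ltW.
have sine_ge_cos (c d : R) j' : c ^+ 2 + d ^+ 2 = 1 -> 0 <= d ->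
    cosine K j' ^+ 2 <= c ^+ 2 -> d <= sine K j'.
  move=> cd d0 le_c; rewrite -(@ler_pXn2r _ 2) ?nnegrE ?(ltW (sine_gt0 _)) //.
  by have := cosine2_sine2 j'; lra.
have sqr_le (x y : R) : y <= x -> x <= - y -> x ^+ 2 <= y ^+ 2.
  move=> xy yx; rewrite -subr_ge0.
  have -> : y ^+ 2 - x ^+ 2 = (x - y) * (- y - x) by ring.
  by rewrite mulr_ge0 // subr_ge0.
have cos_ge := fun j' => cos_le_cosine psi j' psiB mac.
(* By [corner_add], a largest corner faces a smallest one. *)
have le_min : corner K (i + 2) <= corner K (i + 1) /\ corner K (i + 2) <= corner K (i - 1).
  by have := corner_add K i; have := imax (i + 1); have := imax (i - 1); lra.
have c01 : 0 <= cosine K i + cosine K (i + 1) by exact: cosine_add_ge0.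
have c12 : cosine K (i + 1) + cosine K (i + 2) <= 0.
  by have := cosine_add_le0 (i + 1); rewrite !I4E; apply.
have c23 : cosine K (i + 2) + cosine K (i - 1) <= 0.
  by have := cosine_add_le0 (i + 2); rewrite !I4E; apply; case: le_min.
(* [MAC] at [i + 1] bounds this cosine below by [cos psi]; [MAC] at [i + 2], through [c12], bounds
   it above by [- cos psi]. *)
have s1 : sin psi <= sine K (i + 1).
  apply: (sine_ge_cos (cos psi)); rewrite ?(ltW s0) //.
  by apply: sqr_le (cos_ge _) _; have := cos_ge (i + 2); lra.
have s3 : sin psi <= sine K (i - 1).
  apply: (sine_ge_cos (cos psi)); rewrite ?(ltW s0) //.
  by apply: sqr_le (cos_ge _) _; have := cos_ge (i + 2); lra.
(* Cancelling the common side in [corner K (i + 1) <= corner K i] leaves [sine K (i + 1) * side K (i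
   + 1) <= sine K i * side K (i - 1)], and [clos] compares these two opposite sides. *)
have si : sin psi * Num.min 1 Cl <= sine K i.
  have := imax (i + 1); rewrite !cornerE !I4E [side K i * _]mulrC !mulrA.
  rewrite ler_pM2r ?side_gt0 // => le_i.
  have /andP[+ _] := clo (i + 1); rewrite !I4E ler_pdivlMr ?side_gt0 // => le_l.
  rewrite -(ler_pM2r (side_gt0 (i - 1))); apply: le_trans le_i.
  rewrite -mulrA; apply: ler_pM s1 _;
    rewrite ?mulr_ge0 ?(ltW s0) ?(ltW min0) ?(ltW (side_gt0 _)) //.
  by apply: le_trans le_l; rewrite ler_wpM2r // ltW ?side_gt0.
have [-> //|->|->|->] := I4P i j; [exact: weak| |exact: weak].
(* If the angle at [i + 2] is not acute, [MAC] alone bounds its sine. If it is acute, [c12] and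
   [c01] give [0 < cosine K (i + 2) <= cosine K i], so its sine is at least the one at [i]. *)
have [c2|c2] := leP (cosine K (i + 2)) 0.
  apply: weak; apply: (sine_ge_cos (cos psi)); rewrite ?(ltW s0) //.
  by apply: sqr_le (cos_ge _) _; have := cos_ge (i + 2); lra.
apply: le_trans si _; apply: (sine_ge_cos (cosine K i));
  rewrite ?cosine2_sine2 ?(ltW (sine_gt0 _)) //.
by nra.
Qed.

End Convex.
End Corners.

(** * From the quadrilateral to the reference element *)

Section Reference.
Context {R : realType}.
Implicit Types (K : 'I_4 -> 'cV[R]_2) (i j : 'I_4) (u v P Q S U W : 'cV[R]_2).

Lemma sin_angle P Q S : cross (P - Q) (S - Q) != 0 ->
  sin (angle P Q S) = `|cross (P - Q) (S - Q)| / (enorm (P - Q) * enorm (S - Q)).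
Proof.
move=> nz; rewrite /angle sin_acos ?cos_div_bound //.
rewrite -(sin_cos_unit _ _ nz) addrC addKr sqrtr_sqr normrM normfV.
by congr (_ / _); rewrite ger0_norm // mulr_ge0 ?enorm_ge0.
Qed.

Lemma ref_quadE (a b at_ bt : R) :
  (ref_quad a b at_ bt 0 = pt 0 0) * (ref_quad a b at_ bt 1 = pt a 0) *
  (ref_quad a b at_ bt 2 = pt at_ bt) * (ref_quad a b at_ bt (- 1) = pt 0 b).
Proof. by []. Qed.

Lemma I4cases (P : 'I_4 -> Prop) : P 0 -> P 1 -> P 2 -> P (- 1) -> forall i, P i.
Proof. by move=> P0 P1 P2 P3 i; have [->|->|->|->] := I4P 0 i; rewrite ?add0r. Qed.

Lemma I4num : (0 + 1 = 1 :> 'I_4) * (0 + 2 = 2 :> 'I_4) * (0 - 1 = -1 :> 'I_4) *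
  (1 + 1 = 2 :> 'I_4) * (1 + 2 = -1 :> 'I_4) * (1 - 1 = 0 :> 'I_4) *
  (2 + 1 = -1 :> 'I_4) * (2 + 2 = 0 :> 'I_4) * (2 - 1 = 1 :> 'I_4) *
  (-1 + 1 = 0 :> 'I_4) * (-1 + 2 = 1 :> 'I_4) * (-1 - 1 = 2 :> 'I_4).
Proof. by do !split; apply/val_inj. Qed.

(** With [s] and [t] as the ratios in [D1'], convexity reads [s], [t], [s + t - 1 > 0] when [a] and
    [b] are positive. *)
Lemma corner_ref (a b s t : R) (K := ref_quad a b (s * a) (t * b)) :
  (corner K 0 = a * b) * (corner K 1 = t * (a * b)) *
  (corner K 2 = (s + t - 1) * (a * b)) * (corner K (- 1) = s * (a * b)).
Proof.
by do !split; rewrite /corner /K !I4num !ref_quadE /cross !mxE /=; ring.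
Qed.

(** Affine maps commute with convex combinations, whose weights are merely permuted by [tau]; the
    translation is absorbed because the weights sum to 1. *)
Lemma image_region (A : 'M[R]_2) P K K' (tau : 'I_4 -> 'I_4) : bijective tau ->
  (forall j, A *m K (tau j) + P = K' j) ->
  [set A *m x + P | x in region K] = region K'.
Proof.
move=> tau_bij KK'; have [tau' tauK tau'K] := tau_bij.
have affine_sum (w : 'I_4 -> R) : \sum_i w i = 1 ->
    A *m (\sum_i w i *: K i) + P = \sum_j w (tau j) *: K' j.
  move=> w1; under [RHS]eq_bigr do rewrite -KK' scalerDr.
  rewrite big_split /= -scaler_suml.
  rewrite -(reindex tau (P := xpredT) (F := w)); last exact: onW_bij.
  rewrite w1 scale1r mulmx_sumr (reindex tau) /=; last exact: onW_bij.
  by congr (_ + _); apply: eq_bigr => j _; rewrite scalemxAr.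
apply/seteqP; split => [_ [_ [w [w0 w1 ->]] <-]|x [w [w0 w1 ->]]].
  exists (w \o tau); split => //=; last exact: affine_sum.
  by rewrite -w1 [RHS](reindex tau) //; apply: onW_bij.
have w'1 : \sum_i w (tau' i) = 1.
  rewrite -w1 [LHS](reindex tau) /=; last exact: onW_bij.
  by apply: eq_bigr => j _; rewrite tauK.
exists (\sum_i w (tau' i) *: K i); first by exists (w \o tau'); split=> // i; exact: w0.
by rewrite affine_sum //; apply: eq_bigr => j _; rewrite tauK.
Qed.

(** The relabelling [tau] chooses the vertex sent to the origin and the direction in which the
    others are read, so that either side issued from it can play the role of [U]. *)
Lemma equiv_to_reference_coords K (tau : 'I_4 -> 'I_4) (s t c C0 e Cu : R)
    (U := K (tau 1) - K (tau 0)) (W := K (tau (- 1)) - K (tau 0)) :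
  bijective tau -> 0 < c -> 0 < C0 -> 0 < e ->
  K (tau 2) - K (tau 0) = s *: U + t *: W ->
  C0 <= s <= 1 -> C0 <= t <= 1 -> e <= s + t - 1 ->
  0 < enorm U <= enorm W -> c * (enorm U * enorm W) <= `|cross U W| ->
  enorm (K (tau 2) - K (tau (- 1))) <= Cu * enorm U ->
  equiv_to_reference (2 / c) (4 * Cu / (c * e)) C0 K.
Proof.
move=> tau_bij c0 C00 e0 K2 sB tB ste /andP[U0 UW] angU K23.
set a := enorm U in U0 UW angU *; set b := enorm W in UW angU *.
have b0 : 0 < b by exact: lt_le_trans UW.
have ab0 : 0 < a * b by exact: mulr_gt0.
have s0 : 0 < s by case/andP: sB => + _; apply: lt_le_trans.
have t0 : 0 < t by case/andP: tB => + _; apply: lt_le_trans.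
have st0 : 0 < s + t - 1 by exact: lt_le_trans ste.
(* The columns of [G] are the unit vectors along [U] and [W], so its determinant is the signed sine
   of their angle. *)
pose G : 'M[R]_2 := \matrix_(i, j) (if j == 0 then U i 0 / a else W i 0 / b).
have GE x : G *m x = (x 0 0 / a) *: U + (x 1 0 / b) *: W.
  by apply: cV2P; rewrite mulmx2E !mxE /=; ring.
have detG : \det G = cross U W / (a * b).
  by rewrite det2E ![G _ _]mxE /cross /= invfM; ring.
have c_det : c <= `|\det G|.
  by rewrite detG normrM normfV (gtr0_norm ab0) ler_pdivlMr.
have det0 : 0 < `|\det G| by exact: lt_le_trans c_det.
have Gu : G \in unitmx by rewrite unitmxE unitfE -normr_gt0.
have normG x : enorm (G *m x) <= `|x 0 0| + `|x 1 0|.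
  rewrite GE (le_trans (ler_enormD _ _)) // !enormZ !normrM !normfV.
  by rewrite !(gtr0_norm U0, gtr0_norm b0) !divfK ?gt_eqF.
(* This gives [2 <= 2 / c], so that one constant bounds both [G] and its inverse. *)
have c_le1 : c <= 1.
  have := le_trans angU (cross_le U W); rewrite -/a -/b.
  by rewrite ger_pMl.
have G2 x : enorm (G *m x) <= 2 * enorm x.
  apply: (le_trans (normG x)); rewrite mulrDl mul1r.
  by apply: lerD; exact: coord_le_enorm.
have GV2 x : enorm (invmx G *m x) <= 2 / c * enorm x.
  set y := invmx G *m x; have xE : x = G *m y by rewrite mulKVmx.
  (* Cramer's rule: the columns of [G] have norm at most 1, hence each coordinate of [y] is at most
     [enorm x / c]. *)
  have y0 : y 0 0 * \det G = cross x (G *m pt 0 1).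
    by rewrite xE cross_mulmx /cross !ptE; ring.
  have y1 : y 1 0 * \det G = cross (G *m pt 1 0) x.
    by rewrite xE cross_mulmx /cross !ptE; ring.
  have G01 : enorm (G *m pt 0 1) <= 1.
    by apply: le_trans (normG _) _; rewrite !ptE normr0 normr1 add0r.
  have G10 : enorm (G *m pt 1 0) <= 1.
    by apply: le_trans (normG _) _; rewrite !ptE normr0 normr1 addr0.
  have y0c : `|y 0 0| <= c^-1 * enorm x.
    rewrite ler_pdivlMl // mulrC; apply: (@le_trans _ _ (`|y 0 0| * `|\det G|)).
      by rewrite ler_wpM2l.
    rewrite -normrM y0; apply: (le_trans (cross_le _ _)).
    by rewrite ler_piMr ?enorm_ge0.
  have y1c : `|y 1 0| <= c^-1 * enorm x.
    rewrite ler_pdivlMl // mulrC; apply: (@le_trans _ _ (`|y 1 0| * `|\det G|)).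
      by rewrite ler_wpM2l.
    rewrite -normrM y1; apply: (le_trans (cross_le _ _)).
    by rewrite ler_piMl ?enorm_ge0.
  by apply: le_trans (enorm_le_coord y) _; lra.
have refE j : G *m ref_quad a b (s * a) (t * b) j = K (tau j) - K (tau 0).
  elim/I4cases: j; rewrite !ref_quadE GE !ptE ?mul0r ?scale0r ?add0r ?addr0.
  - by rewrite subrr.
  - by rewrite mulfV ?gt_eqF // scale1r.
  - by rewrite !mulfK ?gt_eqF.
  - by rewrite mulfV ?gt_eqF // scale1r.
exists a, b, (s * a), (t * b); split.
- split; rewrite ?mulr_gt0 //; apply/corner_gt0; elim/I4cases; rewrite corner_ref //.
  + by rewrite mulr_gt0.
  + by rewrite mulr_gt0.
  + by rewrite mulr_gt0.
- by rewrite /D1' !mulfK ?gt_eqF.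
(* The inverse sine is the product of the two sides of the triangle at [pt 0 b] over twice its area.
   The sides are at most [2 * b], since [a <= b], and [2 / c * (Cu * a)]; twice the area is at least
   [e * (a * b)]. *)
- have crossE : cross (pt a 0 - pt 0 b) (pt (s * a) (t * b) - pt 0 b) = (s + t - 1) * (a * b).
    by rewrite /cross !mxE /=; ring.
  have cpos : 0 < (s + t - 1) * (a * b) by exact: mulr_gt0.
  have nz : cross (pt a 0 - pt 0 b) (pt (s * a) (t * b) - pt 0 b) != 0.
    by rewrite crossE gt_eqF.
  rewrite /D2 sin_angle // crossE gtr0_norm //.
  rewrite div1r invf_div ler_pdivrMr //.
  have d42 : enorm (pt a 0 - pt 0 b) <= 2 * b.
    by apply: le_trans (enorm_le_coord _) _; rewrite !mxE /= subr0 sub0r normrN !gtr0_norm //; lra.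
  have d43 : enorm (pt (s * a) (t * b) - pt 0 b) <= 2 / c * (Cu * a).
    have -> : pt (s * a) (t * b) - pt 0 b = invmx G *m (K (tau 2) - K (tau (- 1))).
      have -> : K (tau 2) - K (tau (- 1)) = (K (tau 2) - K (tau 0)) - (K (tau (- 1)) - K (tau 0)).
        by rewrite opprB addrA subrK.
      by rewrite -!refE -mulmxBr mulKmx // !ref_quadE.
    by apply: le_trans (GV2 _) _; rewrite ler_wpM2l // divr_ge0 // ltW.
  have Cu0 : 0 <= Cu.
    by rewrite -(pmulr_lge0 _ U0); apply: le_trans K23; exact: enorm_ge0.
  apply: (@le_trans _ _ (2 * b * (2 / c * (Cu * a)))).
    by apply: ler_pM; rewrite ?enorm_ge0.
  have -> : 2 * b * (2 / c * (Cu * a)) = 4 * Cu / (c * e) * (e * (a * b)).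
    by field; rewrite !gt_eqF.
  rewrite ler_wpM2l ?ler_pM2r // !mulr_ge0 ?invr_ge0 ?mulr_ge0 // ltW //.
- exists (invmx G), (- (invmx G *m K (tau 0))); split.
  + by rewrite unitmx_inv.
  + apply: (image_region _ _ _ _ tau tau_bij) => j.
    by rewrite -mulmxBr -refE mulKmx.
  + by apply: opnorm_le => x x1; apply: le_trans (GV2 x) _; rewrite ler_piMr // divr_ge0 // ltW.
  + rewrite invmxK; apply: opnorm_le => x x1; apply: le_trans (G2 x) _.
    apply: (@le_trans _ _ 2); first by rewrite ler_piMr.
    by rewrite ler_pdivlMr // ler_piMr.
Qed.

End Reference.

(** * Choice of the constants of the reference element from [MAC] and [clos] *)

Section ToReference.
Context {R : realType}.
Implicit Types (K : 'I_4 -> 'cV[R]_2) (i j : 'I_4).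

Lemma MAC_clos_equiv_to_reference (psi Cl Cu : R) : 0 < psi < pi -> 0 < Cl <= Cu ->
  exists M C C0 : R, [/\ 0 < M, 0 < C, 0 < C0 < 1 &
    forall K, convex_quad K -> MAC psi K -> clos Cl Cu K -> equiv_to_reference M C C0 K].
Proof.
move=> psiB /andP[Cl0 ClCu]; have Cu0 : 0 < Cu by exact: lt_le_trans ClCu.
have [c c0 cP] : exists2 c, 0 < c & forall K i, convex_quad K -> MAC psi K -> clos Cl Cu K ->
    (forall j, corner K j <= corner K i) -> forall j, c <= sine K j.
  exists (sin psi * Num.min 1 Cl) => [|K i cK mac clo imax j]; last exact: sine_ge clo imax.
  by rewrite mulr_gt0 ?sin_gt0_pi // lt_min ltr01.
(* [Cl * c] bounds [s] and [t] from below, by [T3] and [T1], and [e] bounds [s + t - 1], by [T2];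
   the minimum with 1/2 keeps [C0] below 1. *)
pose C0 := Num.min (Cl * c) (1 / 2).
have [C0l C0r] : C0 <= Cl * c /\ C0 <= 1 / 2 by split; rewrite ge_min lexx ?orbT.
have C00 : 0 < C0 by rewrite lt_min mulr_gt0 //; lra.
pose e := Cl ^+ 2 * c; have e0 : 0 < e by rewrite mulr_gt0 ?exprn_gt0.
exists (2 / c), (4 * Cu / (c * e)), C0; split.
- by rewrite divr_gt0.
- by apply: divr_gt0; exact: mulr_gt0.
- by rewrite C00; lra.
move=> K cK mac clo.
pose i := [arg max_(i > ord0) corner K i]%O.
have imax j : corner K j <= corner K i.
  by rewrite /i; case: arg_maxP => // k _; apply.
have sin_ge j : c <= sine K j by exact: (cP K i).
have T0 j : 0 < corner K j by move/corner_gt0: cK.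
have l0 j : 0 < side K j by exact: side_gt0.
have opp_ge j : Cl * side K (j + 2) <= side K j.
  by rewrite -ler_pdivlMr //; case/andP: (clo j).
have opp_le j : side K j <= Cu * side K (j + 2).
  by rewrite -ler_pdivrMr //; case/andP: (clo j).
have corner_ge j : c * (side K j * side K (j - 1)) <= corner K j.
  by rewrite cornerE // ler_pM2r ?mulr_gt0.
have corner_le : corner K i <= side K i * side K (i - 1).
  by rewrite side_prev; apply: le_trans (ler_norm _) (cross_le _ _).
have l2 : Cl * side K i <= side K (i + 2) by have := opp_ge (i + 2); rewrite !I4E.
have l1 : Cl * side K (i - 1) <= side K (i + 1) by have := opp_ge (i + 1); rewrite !I4E.
(* The sine bound turns the corner into a product of sides, [clos] trades the opposite side for one
   at [i], and [corner_le] returns to the corner at [i]. *)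
have T1 : Cl * c * corner K i <= corner K (i + 1).
  apply: le_trans (corner_ge (i + 1)); rewrite !I4E.
  apply: (@le_trans _ _ (Cl * c * (side K i * side K (i - 1)))).
    by rewrite ler_pM2l ?mulr_gt0.
  have -> : Cl * c * (side K i * side K (i - 1)) =
            c * (Cl * side K (i - 1) * side K i) by ring.
  by rewrite ler_pM2l // ler_pM2r.
have T3 : Cl * c * corner K i <= corner K (i - 1).
  apply: le_trans (corner_ge (i - 1)); rewrite !I4E.
  apply: (@le_trans _ _ (Cl * c * (side K i * side K (i - 1)))).
    by rewrite ler_pM2l ?mulr_gt0.
  have -> : Cl * c * (side K i * side K (i - 1)) =
            c * (side K (i - 1) * (Cl * side K i)) by ring.
  by rewrite !ler_pM2l.
have T2 : e * corner K i <= corner K (i + 2).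
  apply: le_trans (corner_ge (i + 2)); rewrite !I4E.
  apply: (@le_trans _ _ (e * (side K i * side K (i - 1)))).
    by rewrite ler_pM2l.
  have -> : e * (side K i * side K (i - 1)) =
            c * (Cl * side K i * (Cl * side K (i - 1))) by rewrite /e; ring.
  by rewrite ler_pM2l // ler_pM // mulr_ge0 // ltW.
pose s := corner K (i - 1) / corner K i; pose t := corner K (i + 1) / corner K i.
have ratioB j : Cl * c * corner K i <= corner K j -> C0 <= corner K j / corner K i <= 1.
  move=> Tj; rewrite ler_pdivlMr // ler_pdivrMr // mul1r imax andbT.
  by apply: le_trans Tj; rewrite ler_pM2r.
have ste : e <= s + t - 1.
  have -> : s + t - 1 = corner K (i + 2) / corner K i.
    by apply: (mulIf (lt0r_neq0 (T0 i))); rewrite mulrBl mulrDl !divfK ?gt_eqF //;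
       have := corner_add K i; lra.
  by rewrite ler_pdivlMr.
(* Cramer's rule in the basis of the two sides at [i], multiplied by the determinant
   [corner K i]. *)
have K2 : K (i + 2) - K i = s *: (K (i + 1) - K i) + t *: (K (i - 1) - K i).
  apply: (scalerI (lt0r_neq0 (T0 i))).
  rewrite [RHS]scalerDr !scalerA /s /t [_ * (_ / _)]mulrC divfK ?gt_eqF //.
  rewrite [_ * (_ / _)]mulrC divfK ?gt_eqF //.
  by apply: cV2P; rewrite !mxE /corner !I4E /cross !mxE; ring.
have cross_ge : c * (side K i * side K (i - 1)) <=
    `|cross (K (i + 1) - K i) (K (i - 1) - K i)|.
  by apply: le_trans (corner_ge i) (ler_norm _).
(* (D2) bounds [a / b] from above, so the edges at [i] are ordered to have
   [a <= b], which may reverse the orientation. *)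
have [le_side|lt_side] := leP (side K i) (side K (i - 1)).
- apply: (equiv_to_reference_coords K (fun j => i + j) s t) => //.
  + by rewrite addr0.
  + exact: ratioB.
  + exact: ratioB.
  + by rewrite addr0 -side_prev le_side andbT l0.
  + by rewrite addr0 -side_prev.
  + by rewrite addr0; have := opp_le (i + 2); rewrite /side enormB !I4E.
- apply: (equiv_to_reference_coords K (fun j => i - j) t s) => //.
  + exact: inv_bij (subKr i).
  + rewrite subr0 opprK [RHS]addrC -K2; congr (K _ - _); exact: val_inj.
  + exact: ratioB.
  + exact: ratioB.
  + by rewrite [t + s]addrC.
  + by rewrite subr0 opprK -side_prev l0 ltW.
  + by rewrite subr0 opprK -side_prev [side _ _ * _]mulrC crossC normrN.
  + rewrite subr0 opprK -side_prev; have := opp_le (i + 1); rewrite !I4E.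
    rewrite /side !I4E; congr (enorm (K _ - _) <= _); exact: val_inj.
Qed.

End ToReference.

(** * From the reference element to the quadrilateral *)

Section FromReference.
Context {R : realType}.
Implicit Types (K Q : 'I_4 -> 'cV[R]_2) (i j : 'I_4) (A : 'M[R]_2) (P : 'cV[R]_2).

(** * Vertices of a region and their images under affine maps *)

Lemma vertex_region K i : region K (K i).
Proof.
exists (fun j => (j == i)%:R); split=> [j||]; first by rewrite ler0n.
- by rewrite (bigD1 i) //= eqxx big1 ?addr0 // => j /negbTE ->.
- by rewrite (bigD1 i) //= eqxx scale1r big1 ?addr0 // => j /negbTE ->; rewrite scale0r.
Qed.

Lemma cross_sumr (w : 'I_4 -> R) (y : 'I_4 -> 'cV[R]_2) (e : 'cV[R]_2) :
  cross e (\sum_j w j *: y j) = \sum_j w j * cross e (y j).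
Proof.
rewrite /cross !summxE !mulr_sumr -sumrB; apply: eq_bigr => j _.
by rewrite !mxE; ring.
Qed.

(* A supporting line parallel to a diagonal meets the region in one vertex. *)
Lemma vertex_unique_max K i x (e := K (i - 1) - K (i + 1)) :
  convex_quad K -> region K x ->
  cross e x <= cross e (K i) ?= iff (x == K i).
Proof.
move=> /corner_gt0 cK [w [w0 w1 ->]].
(* The difference is the corner at [i] for both ends of the diagonal, and the sum of the corners at
   [i] and [i + 2] for the opposite vertex. *)
have gap j : j != i -> cross e (K j) < cross e (K i).
  have Ti := cK i; have T2 := cK (i + 2); move: Ti T2; rewrite /corner !I4E /e /cross !mxE.
  by have [->|->|->|->] := I4P i j; rewrite ?eqxx // => Ti T2 _; lra.
have wi : w i = 1 - \sum_(j | j != i) w j by rewrite -w1 (bigD1 i) //= addrK.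
have gapE : cross e (K i) - cross e (\sum_j w j *: K j) =
    \sum_(j | j != i) w j * (cross e (K i) - cross e (K j)).
  under [RHS]eq_bigr do rewrite mulrBr.
  by rewrite sumrB -mulr_suml cross_sumr (bigD1 i) //= wi; ring.
have term_ge0 j : j != i -> 0 <= w j * (cross e (K i) - cross e (K j)).
  by move=> ji; rewrite mulr_ge0 // subr_ge0 ltW // gap.
split; first by rewrite -subr_ge0 gapE sumr_ge0.
apply/eqP/eqP => [eq_max|-> //].
move: gapE; rewrite eq_max subrr => /esym/psumr_eq0P wgap0.
have wj0 j : j != i -> w j = 0.
  move=> ji; have /eqP := wgap0 term_ge0 j ji.
  by rewrite mulf_eq0 subr_eq0 (gt_eqF (gap j ji)) orbF => /eqP.
rewrite (bigD1 i) //= wi !big1 ?subr0 ?scale1r ?addr0 // => j ji.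
by rewrite wj0 ?scale0r.
Qed.

(** An extreme point argument. The image of [K i] is a convex combination of vertices of [Q]; pulled
    back, it writes [K i] as a combination of points [y j] of the region of [K]. As [K i] is the
    strict maximum of a linear form there, every [y j] with positive weight equals [K i]. *)
Lemma image_vertices K Q A P : convex_quad K -> A \in unitmx ->
  [set A *m x + P | x in region K] = region Q ->
  exists2 sigma : 'I_4 -> 'I_4, injective sigma &
    forall i, A *m K i + P = Q (sigma i).
Proof.
move=> cK Au imK.
have imA_inj : injective (fun x => A *m x + P).
  by move=> x y /addIr /(congr1 (mulmx (invmx A))); rewrite !mulKmx.
have K_inj : injective K.
  move=> i j Kij; apply/eqP; apply: contraT => ij.
  have := vertex_unique_max K i (K j) cK (vertex_region K j).
  move/corner_gt0: (cK) => T; have Ti := T i; have T2 := T (i + 2); move: Ti T2 => + + _.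
  rewrite /corner !I4E; move: Kij ij.
  by have [->|->|->|->] := I4P i j; rewrite ?eqxx // => <- _; rewrite /cross !mxE; lra.
have /choice[y yP] : forall j, exists x, region K x /\ A *m x + P = Q j.
  by move=> j; have := vertex_region Q j; rewrite -imK => -[x Kx <-]; exists x.
suff /choice[sigma sigmaP] : forall i, exists j, A *m K i + P = Q j.
  by exists sigma => // i j ij; apply/K_inj/imA_inj; rewrite /= !sigmaP ij.
move=> i; have [w [w0 w1 KiE]] : region Q (A *m K i + P).
  by rewrite -imK; exists (K i) => //; exact: vertex_region.
have {}KiE : K i = \sum_j w j *: y j.
  apply: imA_inj; rewrite /= KiE mulmx_sumr -[P in RHS]scale1r -w1 scaler_suml -big_split /=.
  by apply: eq_bigr => j _; rewrite -scalemxAr -scalerDr (yP j).2.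
have [j wj] : exists j, 0 < w j.
  apply: contrapT => /forallNP wn; have := ltr01 (R := R); rewrite -w1 big1 ?ltxx // => j _.
  by apply/eqP; rewrite eq_le w0 leNgt andbT; apply/negP/wn.
exists j; rewrite -(yP j).2; congr (A *m _ + P); apply/eqP; rewrite eq_sym.
set e := K (i - 1) - K (i + 1).
have max_y k := vertex_unique_max K i (y k) cK (yP k).1.
rewrite -(max_y j) -/e.
have : \sum_k w k * (cross e (K i) - cross e (y k)) = 0.
  under eq_bigr do rewrite mulrBr.
  by rewrite sumrB -mulr_suml w1 mul1r -cross_sumr -KiE subrr.
move/psumr_eq0P => /(_ _ j isT) => /(_ _)/eqP; rewrite mulf_eq0 (gt_eqF wj) subr_eq0 eq_sym.
by apply=> k _; rewrite mulr_ge0 // subr_ge0 (max_y k).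
Qed.


Lemma left_of_edge K i j : convex_quad K -> j != i -> j != i + 1 ->
  0 < cross (K (i + 1) - K i) (K j - K i).
Proof.
move=> /corner_gt0 T; have := T (i + 1); have := T i; rewrite /corner !I4E.
have [->|->|->|->] := I4P i j; rewrite ?eqxx // => Ti T1 _ _.
by move: T1; rewrite /cross !mxE; lra.
Qed.

Lemma affineB A P (x y : 'cV[R]_2) : (A *m y + P) - (A *m x + P) = A *m (y - x).
Proof. by rewrite opprD addrACA subrr addr0 mulmxBr. Qed.

Lemma det_cross A P (x y z : 'cV[R]_2) :
  cross ((A *m y + P) - (A *m x + P)) ((A *m z + P) - (A *m x + P)) =
  \det A * cross (y - x) (z - x).
Proof. by rewrite !affineB cross_mulmx. Qed.

(* A diagonal separates the other two vertices, a side does not. *)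
Lemma matching_opposite K Q A P (sigma : 'I_4 -> 'I_4) i :
  convex_quad K -> convex_quad Q -> injective sigma ->
  (forall i, A *m K i + P = Q (sigma i)) -> sigma (i + 2) = sigma i + 2.
Proof.
move=> cK cQ sigma_inj KQ.
have T1 : cross (K (i + 2) - K i) (K (i + 1) - K i) < 0.
  move/corner_gt0: cK => /(_ (i + 1)); rewrite /corner !I4E /cross !mxE; lra.
have T3 : 0 < cross (K (i + 2) - K i) (K (i - 1) - K i).
  move/corner_gt0: cK => /(_ (i - 1)); rewrite /corner !I4E /cross !mxE; lra.
(* The factor that comes out is the square of [\det A], so the sign also survives when [A] reverses
   the orientation. *)
have sep : cross (Q (sigma (i + 2)) - Q (sigma i)) (Q (sigma (i + 1)) - Q (sigma i)) *
    cross (Q (sigma (i + 2)) - Q (sigma i)) (Q (sigma (i - 1)) - Q (sigma i)) <= 0.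
  rewrite -!KQ !det_cross mulrACA -expr2 mulr_ge0_le0 ?sqr_ge0 //.
  by rewrite mulr_le0_ge0 // ltW.
have ne (j k : 'I_4) : j != k -> sigma j != sigma k by rewrite (inj_eq sigma_inj).
have [n0 n1 n3 [n01 n03]] : [/\ i + 2 != i, i + 1 != i + 2, i - 1 != i + 2 &
    i + 1 != i /\ i - 1 != i].
  by move: (i) => [[|[|[|[|//]]]]] i4.
have [E|E|//|E] := I4P (sigma i) (sigma (i + 2)).
- by have := ne _ _ n0; rewrite E eqxx.
- have := mulr_gt0 (left_of_edge Q (sigma i) (sigma (i + 1)) cQ (ne _ _ n01) _)
     (left_of_edge Q (sigma i) (sigma (i - 1)) cQ (ne _ _ n03) _).
  by rewrite -E leNgt in sep *; move/(_ (ne _ _ n1) (ne _ _ n3)) => h; rewrite h in sep.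
(* Here the segment runs backwards along a side of [Q], which has the other two vertices on its
   right. *)
- have right j : j != i -> j != i + 2 ->
      cross (Q (sigma (i + 2)) - Q (sigma i)) (Q (sigma j) - Q (sigma i)) < 0.
    move=> ji j2; have := left_of_edge Q (sigma i - 1) (sigma j) cQ.
    rewrite I4E -E => /(_ (ne _ _ j2) (ne _ _ ji)).
    by rewrite /cross !mxE; lra.
  by move: sep; rewrite leNgt nmulr_rgt0 right.
Qed.

(** The values [sigma i] and [sigma i + 2] are taken by [i] and [i + 2]; the two remaining cases are
    those of a rotation and of a reflection. *)
Lemma opposite_vertex_cases (sigma : 'I_4 -> 'I_4) i : injective sigma ->
  (forall i, sigma (i + 2) = sigma i + 2) ->
  (sigma (i + 1) = sigma i + 1 /\ sigma (i - 1) = sigma i - 1) \/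
  (sigma (i + 1) = sigma i - 1 /\ sigma (i - 1) = sigma i + 1).
Proof.
move=> sigma_inj opp; have := opp (i + 1); rewrite !I4E => ->.
have [E|->|E|->] := I4P (sigma i) (sigma (i + 1)); rewrite ?I4E; [|by left| |by right].
  by move/sigma_inj: E; move: (i) => [[|[|[|[|//]]]]].
by move: E; rewrite -opp => /sigma_inj; move: (i) => [[|[|[|[|//]]]]].
Qed.

(** Lengths change by a factor at most [M] in either direction, whence [M ^+ 2] for their ratios.
    Corners are multiplied by [|\det A| <= M ^+ 2], and the product of two sides costs another
    [M ^+ 2], whence [M ^+ 4] for the sines. *)
Lemma transfer_regularity K Q A P (sigma : 'I_4 -> 'I_4) (M N c : R) :
  convex_quad K -> 0 < M -> 0 <= N -> 0 <= c ->
  injective sigma -> (forall i, sigma (i + 2) = sigma i + 2) ->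
  (forall i, A *m K i + P = Q (sigma i)) -> convex_quad Q ->
  (forall x : 'cV[R]_2, enorm (A *m x) <= M * enorm x) ->
  (forall x : 'cV[R]_2, enorm x <= M * enorm (A *m x)) ->
  (forall i, side Q i <= N * side Q (i + 2)) ->
  (forall i, c * (side Q i * side Q (i - 1)) <= corner Q i) ->
  (forall i, side K i <= M ^+ 2 * N * side K (i + 2)) /\
  (forall i, c / M ^+ 4 <= sine K i).
Proof.
move=> cK M0 N0 c0 sigma_inj opp KQ cQ AM AVM sideQ cornerQ.
have AK i j : A *m (K j - K i) = Q (sigma j) - Q (sigma i).
  by rewrite -!KQ affineB.
split=> i; have := opposite_vertex_cases sigma i sigma_inj opp.
  have le_i := AVM (K (i + 1) - K i); have le_i2 := AM (K (i - 1) - K (i + 2)).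
  rewrite !AK in le_i le_i2 => cases.
  suff le_Q : enorm (Q (sigma (i + 1)) - Q (sigma i)) <=
      N * enorm (Q (sigma (i - 1)) - Q (sigma (i + 2))).
    rewrite /side I4E; apply: (le_trans le_i); rewrite -!mulrA ler_pM2l //.
    apply: (le_trans le_Q); rewrite [leRHS]mulrCA ler_wpM2l //.
  case: cases => -[-> ->]; rewrite opp.
    by have := sideQ (sigma i); rewrite /side !I4E.
  by have := sideQ (sigma i - 1); rewrite /side !I4E enormB [X in _ <= _ * X]enormB.
have detM : `|\det A| <= M ^+ 2.
  have := cross_le (A *m pt 1 0) (A *m pt 0 1); rewrite cross_mulmx.
  have e1 : enorm (pt 1 0 : 'cV[R]_2) <= 1.
    by apply: le_trans (enorm_le_coord _) _; rewrite !ptE normr0 normr1 addr0.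
  have e2 : enorm (pt 0 1 : 'cV[R]_2) <= 1.
    by apply: le_trans (enorm_le_coord _) _; rewrite !ptE normr0 normr1 add0r.
  rewrite [cross (pt _ _) _]/cross !ptE mulr1 mulr0 subr0 mulr1 => /le_trans; apply.
  rewrite expr2 ler_pM ?enorm_ge0 //; apply: le_trans (AM _) _; exact: ler_piMr (ltW M0) _.
have TK : 0 < corner K i by move/corner_gt0: cK.
move=> cases.
have cornerE' : corner Q (sigma i) = `|\det A| * corner K i.
  rewrite -[corner K i in RHS]gtr0_norm // -normrM.
  rewrite -(gtr0_norm (x := corner Q _)); last by move/corner_gt0: cQ.
  rewrite /corner -(det_cross A P) !KQ.
  by case: cases => -[-> ->] //; rewrite crossC normrN.
have le1 := AVM (K (i + 1) - K i); have le3 := AVM (K (i - 1) - K i).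
rewrite !AK in le1 le3.
have sidesE : enorm (Q (sigma (i + 1)) - Q (sigma i)) * enorm (Q (sigma (i - 1)) - Q (sigma i))
     = side Q (sigma i) * side Q (sigma i - 1).
  by rewrite side_prev /side; case: cases => -[-> ->] //; rewrite mulrC.
rewrite /sine ler_pdivlMr ?mulr_gt0 ?side_gt0 // mulrAC ler_pdivrMr ?exprn_gt0 //.
apply: (@le_trans _ _ (M ^+ 2 * corner Q (sigma i))).
  apply: (@le_trans _ _ (M ^+ 2 * (c * (side Q (sigma i) * side Q (sigma i - 1))))).
    rewrite -sidesE [leRHS]mulrCA ler_wpM2l // side_prev /side.
    have -> : forall x y, M ^+ 2 * (x * y) = (M * x) * (M * y) by move=> x y; ring.
    by rewrite ler_pM ?enorm_ge0.
  by rewrite ler_pM2l ?exprn_gt0.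
rewrite cornerE' mulrA [leRHS]mulrC ler_pM2r //.
have -> : M ^+ 4 = M ^+ 2 * M ^+ 2 by ring.
by rewrite ler_pM2l ?exprn_gt0.
Qed.

(** Each part of [N] serves one comparison of opposite sides, [p] and [q] being those facing [b] and
    [a]: [p <= (1 + C / C0) * b], [q <= C * a], and [C0^-1] for the reverse inequalities. *)
Lemma reference_regularity (C C0 a b at_ bt : R) (Q := ref_quad a b at_ bt)
    (N := 1 + C / C0 + C + C0^-1) :
  0 < C -> 0 < C0 < 1 -> reference_element a b at_ bt ->
  D1' C0 a b at_ bt -> D2 C a b at_ bt ->
  (forall i, side Q i <= N * side Q (i + 2)) /\
  (forall i, C0 / (2 * N) * (side Q i * side Q (i - 1)) <= corner Q i).
Proof.
move=> C_gt0 /andP[C0_gt0 C0_lt1] [a0 b0 at0 bt0 cQ] [].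
pose s := at_ / a; pose t := bt / b; rewrite -/s -/t.
have atE : at_ = s * a by rewrite /s divfK ?gt_eqF.
have btE : bt = t * b by rewrite /t divfK ?gt_eqF.
clearbody s t; rewrite {}/Q {}atE {}btE in cQ at0 bt0 *.
set Q := ref_quad _ _ _ _ in cQ *.
move=> /andP[C0s s1] /andP[C0t t1].
have ab0 : 0 < a * b by exact: mulr_gt0.
have T0 : 0 < (s + t - 1) * (a * b).
  by move/corner_gt0: (cQ) => /(_ 2); rewrite corner_ref.
have crossE : cross (pt a 0 - pt 0 b) (pt (s * a) (t * b) - pt 0 b) = (s + t - 1) * (a * b).
  by rewrite /cross !mxE /=; ring.
have nz : cross (pt a 0 - pt 0 b) (pt (s * a) (t * b) - pt 0 b) != 0.
  by rewrite crossE gt_eqF.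
rewrite /D2 sin_angle // crossE gtr0_norm // div1r invf_div ler_pdivrMr //.
set d := enorm (pt a 0 - pt 0 b); set q := enorm (pt (s * a) (t * b) - pt 0 b).
move=> dq.
pose p := enorm (pt (s * a) (t * b) - pt a 0).
have s0 : side Q 0 = a.
  rewrite /side /Q !I4num !ref_quadE /enorm dotpE !mxE /= !subr0 mulr0 addr0 -expr2.
  by rewrite sqrtr_sqr gtr0_norm.
have s3 : side Q (- 1) = b.
  rewrite /side /Q !I4num !ref_quadE /enorm dotpE !mxE /= subr0 mulr0 add0r sub0r mulrNN -expr2.
  by rewrite sqrtr_sqr gtr0_norm.
have s1E : side Q 1 = p by rewrite /side /Q !I4num !ref_quadE.
have s2E : side Q 2 = q by rewrite /side /Q !I4num !ref_quadE enormB.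
have ad : a <= d.
  by have := coord_le_enorm (pt a 0 - pt 0 b) 0; rewrite !mxE /= subr0 gtr0_norm.
have bd : b <= d.
  by have := coord_le_enorm (pt a 0 - pt 0 b) 1; rewrite !mxE /= sub0r normrN gtr0_norm.
have q_ge : C0 * a <= q.
  have := coord_le_enorm (pt (s * a) (t * b) - pt 0 b) 0; rewrite !mxE /= subr0 gtr0_norm //.
  by apply: le_trans; rewrite ler_pM2r.
have p_ge : C0 * b <= p.
  have := coord_le_enorm (pt (s * a) (t * b) - pt a 0) 1; rewrite !mxE /= subr0 gtr0_norm //.
  by apply: le_trans; rewrite ler_pM2r.
have p_le : p <= a + b.
  apply: le_trans (enorm_le_coord _) _; rewrite !mxE /= subr0 (gtr0_norm bt0).
  rewrite ler0_norm; last by nra.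
  nra.
have q0 : 0 < q by apply: lt_le_trans q_ge; exact: mulr_gt0.
have p0 : 0 < p by apply: lt_le_trans p_ge; exact: mulr_gt0.
(* Since [s + t - 1 <= 1], [D2] bounds the diagonal [d] times [q]. With [b <= d] this yields [q_le];
   with [a <= d] and [C0 * a <= q] it yields [a_le]. *)
have dq_le : d * q <= C * (a * b).
  by apply: (le_trans dq); rewrite ler_pM2l // ger_pMl //; lra.
have q_le : q <= C * a.
  rewrite -(ler_pM2r b0) -mulrA; apply: le_trans dq_le.
  by rewrite mulrC ler_pM2r.
have a_le : a <= C / C0 * b.
  rewrite mulrAC ler_pdivlMr // -(ler_pM2l a0) mulrA [leRHS]mulrCA; apply: le_trans dq_le.
  rewrite -mulrA [a * C0]mulrC; by apply: ler_pM; rewrite // ?mulr_ge0 // ltW.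
have CC0 : 0 < C / C0 by exact: divr_gt0.
have C0V : 0 < C0^-1 by rewrite invr_gt0.
have N1 : 1 <= N by rewrite /N; lra.
have N0 : 0 < N by lra.
split.
- elim/I4cases; rewrite !I4num ?s0 ?s1E ?s2E ?s3.
  + have : a <= C0^-1 * q by rewrite ler_pdivlMl.
    by rewrite /N; nra.
  + by rewrite /N; nra.
  + by rewrite /N; nra.
  + have : b <= C0^-1 * p by rewrite ler_pdivlMl.
    by rewrite /N; nra.
have key x T : x <= 2 * N / C0 * T -> C0 / (2 * N) * x <= T.
  move=> h; rewrite mulrAC ler_pdivrMr ?mulr_gt0 // mulrC -ler_pdivlMr //.
  by apply: le_trans h _; rewrite mulrAC [T * _]mulrC.
have pN : p <= N * b by rewrite /N; nra.
have C0N : 1 <= N / C0 by rewrite ler_pdivlMr // mul1r; lra.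
have CN : C <= N / C0 by rewrite ler_pdivlMr //; rewrite /N; nra.
have weaken (x r X : R) : 0 < X -> 1 <= r -> x <= X -> x <= 2 * (r * X).
  move=> X0 r1 xX; have : 0 <= (r - 1) * X by rewrite mulr_ge0 ?subr_ge0 ?(ltW X0).
  lra.
have qN : q <= N * a by apply: (le_trans q_le); rewrite ler_pM2r // /N; lra.
elim/I4cases; rewrite !I4num corner_ref ?s0 ?s1E ?s2E ?s3; apply: key.
- have -> : 2 * N / C0 * (a * b) = 2 * (N / C0 * (a * b)) by ring.
  exact: weaken.
- have -> : 2 * N / C0 * (t * (a * b)) = 2 * (t / C0 * (N * b * a)) by ring.
  apply: weaken; rewrite ?ler_pM2r // ?mulr_gt0 //.
  by rewrite ler_pdivlMr // mul1r.
(* At the vertex opposite to the origin the factor [s + t - 1] has to be kept, so [dq] is used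
   instead of [dq_le], together with [p <= a + b <= 2 * d]. *)
- apply: (@le_trans _ _ (2 * (d * q))).
    rewrite [d * q]mulrC mulrCA ler_pM2l //; lra.
  rewrite -!mulrA ler_pM2l // mulrA; apply: (le_trans dq).
  by rewrite ler_pM2r.
- have -> : 2 * N / C0 * (s * (a * b)) = 2 * (s / C0 * (b * (N * a))) by ring.
  apply: weaken; rewrite ?ler_pM2l // ?mulr_gt0 //.
  by rewrite ler_pdivlMr // mul1r.
Qed.

End FromReference.

(** * Angle and side conditions with uniform constants *)

Section Converse.
Context {R : realType}.
Implicit Types (K Q : 'I_4 -> 'cV[R]_2) (i j : 'I_4) (A : 'M[R]_2) (P : 'cV[R]_2).

Lemma le_acos (x y : R) : -1 <= x -> x <= y -> y <= 1 -> acos y <= acos x.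
Proof.
move=> x1 xy y1; have xB : -1 <= x <= 1 by rewrite x1 (le_trans xy).
have yB : -1 <= y <= 1 by rewrite y1 (le_trans x1).
rewrite leNgt -ltr_cos ?in_itv /= ?acos_ge0 ?acos_lepi //.
by rewrite !acosK ?in_itv //= -leNgt.
Qed.

(** A sine of at least [c] keeps the cosine in [[- k, k]] with [k = sqrt (1 - c ^+ 2) < 1], and the
    arccosine turns this into an interval inside [(0, pi)]. *)
Lemma DAC_of_sine_ge (c : R) : 0 < c < 1 ->
  exists psim psiM : R, [/\ 0 < psim, psim <= psiM, psiM < pi &
    forall K, convex_quad K -> (forall i, c <= sine K i) -> DAC psim psiM K].
Proof.
move=> /andP[c0 c1]; set k := Num.sqrt (1 - c ^+ 2).
have k2 : k ^+ 2 = 1 - c ^+ 2 by rewrite sqr_sqrtr //; nra.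
have k0 : 0 <= k by exact: sqrtr_ge0.
have k1 : k < 1 by rewrite -(@ltr_pXn2r _ 2) ?nnegrE // expr1n k2; nra.
have psim0 : 0 < acos k by rewrite acos_gt0 // k1 andbT; lra.
have psiMpi : acos (- k) < pi by rewrite acos_ltpi //; lra.
exists (acos k), (acos (- k)); split => //; first by apply: le_acos; lra.
move=> K cK sineK; have cosK i : - k <= cosine K i <= k.
  rewrite -ler_norml -(@ler_pXn2r _ 2) ?nnegrE // real_normK ?num_real // k2.
  have := cosine2_sine2 K cK i; have := sineK i; nra.
split; split=> // i; rewrite inner_angleE; have /andP[? ?] := cosK i; apply: le_acos; lra.
Qed.

Lemma equiv_to_reference_DAC_clos (M C C0 : R) : 0 < M -> 0 < C -> 0 < C0 < 1 ->
  exists psim psiM Cl Cu : R,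
    [/\ 0 < psim, psim <= psiM, psiM < pi, 0 < Cl <= Cu &
    forall K, convex_quad K -> equiv_to_reference M C C0 K ->
      DAC psim psiM K /\ clos Cl Cu K].
Proof.
move=> M0 C_gt0 C0B; have C0_gt0 : 0 < C0 by case/andP: C0B.
pose N := 1 + C / C0 + C + C0^-1.
have N0 : 0 < N.
  have : 0 < C / C0 by exact: divr_gt0.
  by have : 0 < C0^-1 by [rewrite invr_gt0]; rewrite /N; lra.
pose c := C0 / (2 * N); have c0 : 0 < c by apply: divr_gt0 => //; exact: mulr_gt0.
(* The minimum with 1/2 keeps the sine bound below 1, as [DAC_of_sine_ge] asks. *)
pose c' := Num.min (1 / 2) (c / M ^+ 4).
have [c'l c'r] : c' <= 1 / 2 /\ c' <= c / M ^+ 4 by split; rewrite ge_min lexx ?orbT.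
have c'0 : 0 < c' by rewrite lt_min (divr_gt0 c0) ?exprn_gt0 // andbT; lra.
have [|psim [psiM [psim0 psimM psiMpi DAC_K]]] := @DAC_of_sine_ge c'.
  by rewrite c'0 /=; lra.
(* The added 1 gives [N'^-1 <= N']; the lower bound in [clos] is the upper one read from the
   opposite side. *)
pose N' := 1 + M ^+ 2 * N.
have N'1 : 1 <= N' by rewrite /N' lerDl mulr_ge0 ?exprn_ge0 // ltW.
exists psim, psiM, N'^-1, N'; split=> //.
  by rewrite invr_gt0 (lt_le_trans ltr01) //= (le_trans _ N'1) // invf_le1 // (lt_le_trans ltr01).
move=> K cK [a [b [at_ [bt [ref d1 d2 [A [P [Au imK AM AVM]]]]]]]].
have cQ : convex_quad (ref_quad a b at_ bt) by case: ref.
have [sigma sigma_inj KQ] := image_vertices _ _ _ _ cK Au imK.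
have opp i := matching_opposite _ _ _ _ _ i cK cQ sigma_inj KQ.
have [sideQ cornerQ] := reference_regularity _ _ _ _ _ _ C_gt0 C0B ref d1 d2.
have [sideK sineK] : (forall i, side K i <= M ^+ 2 * N * side K (i + 2)) /\
    (forall i, c / M ^+ 4 <= sine K i).
  apply: transfer_regularity cK M0 (ltW N0) (ltW c0) sigma_inj opp KQ cQ _ _ sideQ cornerQ => x.
    by apply: le_trans (enorm_mulmx_le _ _) _; rewrite ler_wpM2r ?enorm_ge0.
  rewrite -{1}[x](mulKmx Au); apply: le_trans (enorm_mulmx_le _ _) _.
  by rewrite ler_wpM2r ?enorm_ge0.
split; first by apply: DAC_K => // i; exact: le_trans c'r _.
have sideN' i : side K i <= N' * side K (i + 2).
  by apply: (le_trans (sideK i)); rewrite ler_pM2r ?side_gt0 // lerDr.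
move=> i; rewrite ler_pdivlMr ?ler_pdivrMr ?side_gt0 // sideN' andbT.
by rewrite ler_pdivrMl ?(lt_le_trans ltr01) //; have := sideN' (i + 2); rewrite I4E.
Qed.

End Converse.

Theorem theorem2p3 (R : realType) :
  [/\ (forall psiM Cl Cu : R, 0 < psiM < pi -> 0 < Cl <= Cu ->
        exists M C C0 : R, [/\ 0 < M, 0 < C, 0 < C0 < 1 &
          forall K : 'I_4 -> 'cV[R]_2, convex_quad K ->
            MAC psiM K -> clos Cl Cu K -> equiv_to_reference M C C0 K]),
      (forall psim psiM Cl Cu : R, 0 < psim -> 0 < psiM < pi -> 0 < Cl <= Cu ->
        exists M C C0 : R, [/\ 0 < M, 0 < C, 0 < C0 < 1 &
          forall K : 'I_4 -> 'cV[R]_2, convex_quad K ->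
            DAC psim psiM K -> clos Cl Cu K -> equiv_to_reference M C C0 K])
    & (forall M C C0 : R, 0 < M -> 0 < C -> 0 < C0 < 1 ->
        exists psim psiM Cl Cu : R,
          [/\ 0 < psim, psim <= psiM, psiM < pi, 0 < Cl <= Cu &
          forall K : 'I_4 -> 'cV[R]_2, convex_quad K ->
            equiv_to_reference M C C0 K ->
            (MAC psiM K /\ clos Cl Cu K) /\ (DAC psim psiM K /\ clos Cl Cu K)])].
Proof.
split=> [psiM Cl Cu|psim psiM Cl Cu _ psiB CB|M C C0 M0 C_gt0 C0B].
- exact: MAC_clos_equiv_to_reference.
- have [M [C [C0 [M0 C_gt0 C0B refK]]]] := MAC_clos_equiv_to_reference psiM Cl Cu psiB CB.
  by exists M, C, C0; split=> // K cK [mac _]; exact: refK.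
- have [psim [psiM [Cl [Cu [psim0 psimM psiMpi CB refK]]]]] :=
    equiv_to_reference_DAC_clos M C C0 M0 C_gt0 C0B.
  exists psim, psiM, Cl, Cu; split=> // K cK /(refK K cK)[dac clo].
  by case: (dac).
Qed.
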